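(* For every distribution stopping time $\delta$ there exists a randomized stopping time $\rho$ equivalent to $\delta$, i.e. with $\delta_\rho=\delta$, and $\rho$ is unique up to indistinguishability: if $\rho'$ is another randomized stopping time with $\delta_{\rho'}=\delta$, then $P$-almost surely $\rho_t(\omega)=\rho'_t(\omega)$ for all $t\in[0,T]$.
   Context: Setting: $T>0$; $(\Omega,\mathcal{F},P)$ is a probability space with a filtration $(\mathcal{F}_t)_{t\in[0,T]}$ satisfying the usual conditions: $\mathcal{F}=\bigvee_{t\in[0,T]}\mathcal{F}_t$; $\mathcal{F}_0$ contains all $P$-null sets; and $\mathcal{F}_t=\bigcap_{s>t}\mathcal{F}_s$ (right continuity). Measurability with respect to a $\sigma$-algebra always means with respect to its completion under the underlying measure. A distribution stopping time is a probability measure $\delta$ on $\Omega\times[0,T]$ (with product $\sigma$-algebra $\mathcal{F}\otimes$ Borel) such that (1) the marginal of $\delta$ on $\Omega$ is $P$; (2) for every $t\in[0,T]$, the Radon-Nikodym derivative with respect to $P$ of the measure $\delta^t(A):=\delta(A\times[0,t])$, $A\in\mathcal{F}$, is $\mathcal{F}_t$-measurable. A randomized stopping time is an adapted $[0,1]$-valued process $\rho=(\rho_t)_{t\in[0,T]}$ with right-continuous nondecreasing paths and $\rho_T\equiv 1$. It defines the distribution stopping time $\delta_\rho$ by $\delta_\rho(A\times[0,t])=\int_A\rho_t(\omega)\,P(d\omega)$ for all $t\in[0,T]$, $A\in\mathcal{F}$. The randomized stopping time $\rho$ is equivalent to the distribution stopping time $\delta$ if $\delta_\rho=\delta$. *)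

(* Defs.v *)
From HB Require Import structures.
From mathcomp Require Import all_boot all_order all_algebra.
From mathcomp Require Import all_classical all_reals all_analysis.
From mathcomp Require Import measurable_realfun.

Set Implicit Arguments.
Unset Strict Implicit.
Unset Printing Implicit Defensive.

Import Order.TTheory GRing.Theory Num.Theory.
Import numFieldNormedType.Exports.

Local Open Scope classical_set_scope.
Local Open Scope ring_scope.

(* The interval [0, T]. The positivity of T is part of its type because
   measurable types are pointed. *)
Definition time_point (R : realType) (T : {posnum R}) : Type :=
  {t : R | 0 <= t <= T%:num}.

Definition time_val (R : realType) (T : {posnum R})
  (t : time_point T) : measurableTypeR R := sval t.

Lemma time0_subproof (R : realType) (T : {posnum R}) : 0 <= (0 : R) <= T%:num.
Proof. by rewrite lexx ge0. Qed.

HB.instance Definition _ (R : realType) (T : {posnum R}) :=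
  Choice.on (time_point T).
HB.instance Definition _ (R : realType) (T : {posnum R}) :=
  isPointed.Build (time_point T)
    (exist (fun t : R => 0 <= t <= T%:num) 0 (time0_subproof T)).

(* [0, T] with its Borel sets, which are the traces of the Borel sets of R. *)
Notation time T := (g_sigma_algebra_preimageType (@time_val _ T)).

Definition upto (R : realType) (T : {posnum R}) (t : R) : set (time T) :=
  [set s | time_val s <= t].

Arguments upto {R} T t.

Lemma measurable_upto (R : realType) (T : {posnum R}) (t : R) :
  measurable (upto T t).
Proof.
exists [set` `]-oo, t]]; first exact: measurable_itv.
by rewrite setTI; apply/seteqP; split => s /=; rewrite in_itv.
Qed.

Section completion.
Context d (Omega : measurableType d) (R : realType) (P : probability Omega R).

(* The completion of the sigma-algebra G under the restriction of P to G. *)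
Definition completion (G : set (set Omega)) : set (set Omega) :=
  [set A | exists B C,
    [/\ G B, G C, B `<=` A, A `<=` C & P (C `\` B) = 0%E]].

Definition completion_measurable d' (V : measurableType d')
    (G : set (set Omega)) (f : Omega -> V) : Prop :=
  forall B, measurable B -> completion G (f @^-1` B).

End completion.

Section stopping.
Context d (Omega : measurableType d) (R : realType) (P : probability Omega R).
Variable T : {posnum R}.

(* A filtration indexed by [0, T] is a family indexed by R of which only the
   members with index in [0, T] matter; likewise for processes below. The
   sigma-algebra of the probability space is the one carried by Omega; it need
   not be complete. *)
Record usual_filtration (F : R -> set (set Omega)) : Prop := UsualFiltration {
  filtration_sigma_algebra :
    forall t : R, 0 <= t <= T%:num -> sigma_algebra setT (F t) ;
  filtration_mono :
    forall s t : R, 0 <= s -> s <= t -> t <= T%:num -> F s `<=` F t ;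
  filtration_generates :
    @measurable _ Omega = <<s \bigcup_(t in `[0, T%:num]) F t >> ;
  filtration_null :
    forall A : set Omega, measurable A -> P A = 0%E -> F 0 A ;
  filtration_right_continuous :
    forall t : R, 0 <= t < T%:num -> F t = \bigcap_(s in `]t, T%:num]) F s }.

Section time_section.
Variable delta : probability (Omega * time T)%type R.
Variable t : R.

Definition time_section (A : set Omega) : \bar R := delta (A `*` upto T t).

Let time_section0 : time_section set0 = 0%E.
Proof. by rewrite /time_section set0X measure0. Qed.

Let time_section_ge0 A : (0 <= time_section A)%E.
Proof. exact: measure_ge0. Qed.

Let time_section_sigma_additive : semi_sigma_additive time_section.
Proof.
move=> F mF tF mUF; rewrite /time_section setX_bigcupl.
apply: measure_semi_sigma_additive.
- by move=> i; apply: measurableX => //; exact: measurable_upto.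
- apply/trivIsetP => i j _ _ ij; rewrite -setXI setIid.
  by move/trivIsetP : tF => ->//; rewrite set0X.
- by rewrite -setX_bigcupl; apply: measurableX => //; exact: measurable_upto.
Qed.

HB.instance Definition _ := isMeasure.Build _ _ _ time_section
  time_section0 time_section_ge0 time_section_sigma_additive.

Let time_section_finite : fin_num_fun time_section.
Proof.
move=> A mA; apply: fin_num_measure.
by apply: measurableX => //; exact: measurable_upto.
Qed.

HB.instance Definition _ := @Measure_isFinite.Build _ _ _ time_section
  time_section_finite.

End time_section.

Local Open Scope charge_scope.

Record distribution_stopping_time (F : R -> set (set Omega))
    (delta : probability (Omega * time T)%type R) : Prop :=
  DistributionStoppingTime {
    dst_marginal : forall A : set Omega, measurable A -> delta (A `*` setT) = P A ;
    dst_adapted : forall t : R, 0 <= t <= T%:num ->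
      completion_measurable P (F t)
        ('d (charge_of_finite_measure (time_section delta t)) '/d P) }.

Record randomized_stopping_time (F : R -> set (set Omega))
    (rho : R -> Omega -> R) : Prop := RandomizedStoppingTime {
  rst_adapted : forall t : R, 0 <= t <= T%:num ->
    completion_measurable P (F t) (rho t) ;
  rst_itv : forall (t : R) w, 0 <= t <= T%:num -> 0 <= rho t w <= 1 ;
  rst_nondecreasing : forall w (s t : R),
    0 <= s -> s <= t -> t <= T%:num -> rho s w <= rho t w ;
  rst_right_continuous : forall w (t : R), 0 <= t < T%:num ->
    rho s w @[s --> t^'+] --> rho t w ;
  rst_final : forall w, rho T%:num w = 1 }.

(* delta_rho = delta, where delta_rho is the measure determined by its values
   on the rectangles A x [0, t]; these form a pi-system generating the product
   sigma-algebra. The integrand is only measurable for the completion of the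
   sigma-algebra of Omega; the integral of a nonnegative function being the
   supremum of the integrals of the measurable simple functions below it, its
   value is that of the integral for the completed measure. *)
Definition equivalent_stopping_times (rho : R -> Omega -> R)
    (delta : probability (Omega * time T)%type R) : Prop :=
  forall (t : R) (A : set Omega), 0 <= t <= T%:num -> measurable A ->
    (delta (A `*` upto T t) = \int[P]_(w in A) (rho t w)%:E)%E.

End stopping.

(* Main.v *)
Require Import Defs.
From HB Require Import structures.
From mathcomp Require Import all_boot all_order all_algebra.
From mathcomp Require Import all_classical all_reals all_analysis.
From mathcomp Require Import measurable_realfun.

Import Order.TTheory GRing.Theory Num.Theory.
Import numFieldNormedType.Exports.

Local Open Scope classical_set_scope.
Local Open Scope ring_scope.

(** Existence. For fixed [s], a density [section_density s] of the measure
    [A |-> delta (A `*` [0, s])] with respect to [P] is only determined up to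
    a null set depending on [s], so the paths of these densities need not be
    monotone or right-continuous. Both regularity properties can be imposed at
    every [w] at once by setting
      [right_envelope t w = inf {section_density q w | q rational, t < q}]:
    the set under the infimum shrinks as [t] grows, and it is the union of the
    corresponding sets for [s > t]. Taking the density to be the constant [1]
    from time [T] on gives the range [[0, 1]] and the final value [1].

    The regularised process is still a density ([right_envelope_ae]). Indeed
    the measures grow with [s], so almost surely
    [section_density t <= section_density q] for all rational [q > t] and hence
    [section_density t <= right_envelope t]. Conversely
    [right_envelope t <= section_density q] everywhere, so its integral over
    [A] is at most [delta (A `*` [0, q])] for every rational [q > t], and this
    decreases to [delta (A `*` [0, t])] as [q] decreases to [t]. Thus it equals
    the Radon-Nikodym derivative almost everywhere; as the sigma-algebras of
    the filtration contain the null sets, adaptedness passes from the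
    derivative to the process ([completion_ae_eq]).

    Uniqueness. Two randomized stopping times equivalent to [delta] have the
    same integrals over every measurable set at every time, hence agree almost
    surely at all rational times simultaneously, hence everywhere by right
    continuity.

    Comparison of integrals yields almost everywhere comparison of functions in
    a single lemma, [ae_le_of_integral_le]. Since an arbitrary randomized
    stopping time is measurable only for the completed sigma-algebras, that
    lemma has to handle integrands which are not measurable. *)

(** * Integrals of functions measurable for the completion *)

Section countable_ae.
Context {d} {Omega : measurableType d} {R : realType}.
Context (mu : {measure set Omega -> \bar R}).

Lemma ae_forall_countable (I : countType) (Q : I -> Omega -> Prop) :
  (forall i, {ae mu, forall w, Q i w}) -> {ae mu, forall w, forall i, Q i w}.
Proof.
move=> aeQ.
have : {ae mu, forall w, forall n, if unpickle n is Some i then Q i w else True}.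
  apply: ae_foralln => n; case: unpickle => [i|]; first exact: aeQ.
  exact: aeW.
by apply: filterS => w Qw i; have := Qw (pickle i); rewrite pickleK.
Qed.

(** The integral of a nonnegative function is the supremum of the integrals of
    the simple functions below it, and this supremum is monotone whether or not
    the integrands are measurable. *)
Lemma ge0_le_integral_nonmeasurable (D : set Omega) (f g : Omega -> \bar R) :
  (forall w, D w -> (0 <= f w)%E) -> (forall w, D w -> (f w <= g w)%E) ->
  (\int[mu]_(w in D) f w <= \int[mu]_(w in D) g w)%E.
Proof.
move=> f0 fg.
have g0 w : D w -> (0 <= g w)%E by move=> Dw; exact: le_trans (f0 _ Dw) (fg _ Dw).
rewrite ge0_integralE // ge0_integralE //.
apply: ereal_sup_le => _ [h hf <-]; exists h => // w.
apply: le_trans (hf w) _; rewrite /patch; case: ifPn => // /set_mem; exact: fg.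
Qed.

End countable_ae.

Section completions.
Context {d} {Omega : measurableType d} {R : realType} (P : probability Omega R).

Lemma completionS (G H : set (set Omega)) :
  G `<=` H -> completion P G `<=` completion P H.
Proof.
by move=> GH A [B [C [GB GC BA AC PBC]]]; exists B, C; split => //; exact: GH.
Qed.

Lemma measurable_completion (A : set Omega) :
  measurable A -> completion P measurable A.
Proof. by move=> mA; exists A, A; split => //; rewrite setDv measure0. Qed.

(** With [N] a measurable null set outside of which [X] and [Y] coincide, a
    sandwich [B `<=` X `<=` C] becomes [B `\` N `<=` Y `<=` C `|` N], whose bounds
    are in [G] because [G] contains the null sets. *)
Lemma completion_ae_eq (G : set (set Omega)) (X Y : set Omega) :
  sigma_algebra setT G -> G `<=` measurable ->
  (forall N, measurable N -> P N = 0%E -> G N) ->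
  {ae P, forall w, X w <-> Y w} -> completion P G X -> completion P G Y.
Proof.
move=> sG Gm Gnull [N [mN PN XYN]] [B [C [GB GC BX XC PBC]]].
have GN := Gnull _ mN PN.
have GE : G = @measurable _ (g_sigma_algebraType G).
  by rewrite /measurable/= sigma_algebra_id.
have XY w : ~ N w -> X w <-> Y w.
  by move=> nNw; apply: contrapT => nXY; apply: nNw; exact: XYN.
have mC := Gm _ GC; have mB := Gm _ GB.
exists (B `\` N), (C `|` N); split.
- by rewrite GE in GB GN *; exact: measurableD.
- by rewrite GE in GC GN *; exact: measurableU.
- by move=> w [Bw nNw]; apply/(XY _ nNw); exact: BX.
- move=> w Yw; have [Nw|nNw] := pselect (N w); first by right.
  by left; apply: XC; apply/(XY _ nNw).
- have : (P ((C `\` B) `|` N) = 0)%E.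
    by apply: null_set_setU => //; exact: measurableD.
  apply: subset_measure0.
  + by apply: measurableD; [exact: measurableU|exact: measurableD].
  + by apply: measurableU => //; exact: measurableD.
  + move=> w [CNw nBNw]; have [Nw|nNw] := pselect (N w); first by right.
    left; case: CNw => // Cw; split => // Bw; exact: nBNw.
Qed.

(** If [f] exceeds [g] at [w], two rationals [a < b] satisfy
    [g w <= a < b <= f w]. The set of such [w] differs by a null set
    from a measurable subset [E], for which [b * P E <= int_E f <= int_E g <= a * P E]
    forces [P E = 0]. There are countably many pairs of rationals. *)
Lemma ae_le_of_integral_le (f g : Omega -> R) :
  (forall w, 0 <= f w) -> (forall w, 0 <= g w) ->
  completion_measurable P measurable f -> completion_measurable P measurable g ->
  (forall A, measurable A ->
    (\int[P]_(w in A) (f w)%:E <= \int[P]_(w in A) (g w)%:E)%E) ->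
  {ae P, forall w, f w <= g w}.
Proof.
move=> f0 g0 mf mg fg.
suff H : {ae P, forall w, forall ab : rat * rat,
    ratr ab.1 < ratr ab.2 :> R -> ~ (g w <= ratr ab.1 /\ ratr ab.2 <= f w)}.
  apply: filterS H => w H; rewrite leNgt; apply/negP => /rat_in_itvoo[a].
  rewrite in_itv /= => /andP[ga] /rat_in_itvoo[b]; rewrite in_itv /= => /andP[ab bf].
  by apply: (H (a, b) ab); split; exact: ltW.
apply: ae_forall_countable => -[a b] /=.
have [ab|_] := ltP (ratr a : R) (ratr b); last exact: aeW.
have [B [C [mB mC BE EC PBC]]] := mg _ (measurable_itv `]-oo, (ratr a : R)]).
have [B' [C' [mB' mC' BE' EC' PBC']]] := mf _ (measurable_itv `[(ratr b : R), +oo[).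
have BI : (P (B `&` B') = 0)%E.
  have mBB : measurable (B `&` B') by exact: measurableI.
  have gB w : (B `&` B') w -> g w <= ratr a.
    by move=> [/BE + _]; rewrite /= in_itv.
  have fB w : (B `&` B') w -> ratr b <= f w.
    by move=> [_ /BE']; rewrite /= in_itv /= andbT.
  (* Any point of the set witnesses 0 <= g <= a there, which is where the
     nonnegativity of a and b comes from. *)
  have [->|/set0P[w0 Bw0]] := eqVneq (B `&` B') set0; first exact: measure0.
  have a0 : 0 <= (ratr a : R) by exact: le_trans (g0 _) (gB _ Bw0).
  have : ((ratr b)%:E * P (B `&` B') <= (ratr a)%:E * P (B `&` B'))%E.
    rewrite -!integral_cst //.
    apply: (@le_trans _ _ (\int[P]_(w in B `&` B') (f w)%:E)%E).
      apply: ge0_le_integral_nonmeasurable => w Bw; rewrite lee_fin ?fB //.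
      by rewrite (le_trans a0) // ltW.
    apply: le_trans (fg _ mBB) _.
    by apply: ge0_le_integral_nonmeasurable => w Bw; rewrite lee_fin ?gB.
  have Pfin : P (B `&` B') \is a fin_num by exact: fin_num_measure.
  have : (0 <= P (B `&` B'))%E by exact: measure_ge0.
  rewrite -(fineK Pfin) -!EFinM !lee_fin => p0 bap; congr EFin.
  apply/eqP; rewrite eq_le p0 andbT leNgt; apply/negP => p1.
  by move: bap; rewrite ler_pM2r // leNgt ab.
exists ((B `&` B') `|` ((C `\` B) `|` (C' `\` B'))); split.
- by apply: measurableU; [exact: measurableI|apply: measurableU; exact: measurableD].
- apply: null_set_setU => //; first exact: measurableI.
    by apply: measurableU; exact: measurableD.
  by apply: null_set_setU => //; exact: measurableD.
- move=> w /= /not_implyP[_ /contrapT[ga bf]].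
  have Cw : C w by apply: EC; rewrite /= in_itv.
  have Cw' : C' w by apply: EC'; rewrite /= in_itv /= bf.
  have [Bw|nBw] := pselect (B w); last by right; left.
  have [Bw'|nBw'] := pselect (B' w); last by right; right.
  by left.
Qed.

Lemma measurable_completion_measurable (f : Omega -> R) :
  measurable_fun setT f -> completion_measurable P measurable f.
Proof.
move=> mf B mB; apply: measurable_completion.
by rewrite -[X in measurable X]setTI; exact: mf.
Qed.

End completions.

(** * Right limits along the rationals *)

Lemma right_lim_eq_of_rat {R : realType} (f g : R -> R) (t u l m : R) :
  t < u -> f s @[s --> t^'+] --> l -> g s @[s --> t^'+] --> m ->
  (forall q : rat, t < ratr q < u -> f (ratr q) = g (ratr q)) -> l = m.
Proof.
move=> tu fl gm fg; apply: contrapT => /eqP; rewrite -subr_eq0 => lm0.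
have : \forall s \near t^'+, f s - g s != 0 /\ s < u.
  near=> s; split; near: s; last exact: nbhs_right_lt.
  exact: cvgr_neq0 (cvgB fl gm) lm0.
move=> [e /= e0 He].
have : t < t + e by rewrite ltrDl.
move=> /rat_in_itvoo[q]; rewrite in_itv /= => /andP[tq qe].
have [] := He (ratr q) _ tq.
  by rewrite /= distrC ger0_norm ?subr_ge0 1?ltW // ltrBlDl.
by move=> + qu; rewrite fg ?tq // subrr eqxx.
Unshelve. all: by end_near. Qed.

(** * Densities of the time sections and their right envelope *)

Section section_density.
Context {d} {Omega : measurableType d} {R : realType} (P : probability Omega R).
Context {T : {posnum R}} (delta : probability (Omega * time T)%type R).
Hypothesis marginal : forall A, measurable A -> delta (A `*` setT) = P A.

Lemma upto_ge (s : R) : T%:num <= s -> upto T s = [set: time T].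
Proof.
move=> Ts; apply/seteqP; split => // u _ /=; apply: le_trans Ts.
by case: u => u /= /andP[].
Qed.

Lemma measurable_setX_upto (A : set Omega) (s : R) :
  measurable A -> measurable (A `*` upto T s).
Proof. by move=> mA; apply: measurableX => //; exact: measurable_upto. Qed.

Lemma time_section_le (A : set Omega) (s t : R) : measurable A -> s <= t ->
  (delta (A `*` upto T s) <= delta (A `*` upto T t))%E.
Proof.
move=> mA st; apply: le_measure; rewrite ?inE; try exact: measurable_setX_upto.
by apply: setSX => // u /= us; exact: le_trans st.
Qed.

Lemma time_section_dominated (s : R) : time_section delta s `<< P.
Proof.
apply/null_content_dominatesP => A mA PA; apply/eqP.
rewrite eq_le measure_ge0 andbT.
have : (delta (A `*` upto T s) <= P A)%E.
  rewrite -marginal //; apply: le_measure; rewrite ?inE.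
  - exact: measurable_setX_upto.
  - exact: measurableX.
  - exact: setSX.
by move/le_trans; apply; rewrite -PA.
Qed.

(** The value [1] from time [T] on is a density of the marginal [P]. With it,
    [right_envelope] can range over all rationals [q > t]: its index set is
    nonempty even for [t = T], and its values are at most [1]. *)
Definition section_density (s : R) (w : Omega) : R :=
  if s < T%:num then fine (Radon_Nikodym_SigmaFinite.f (time_section delta s) P w)
  else 1.

Lemma section_density_ge0 s w : 0 <= section_density s w.
Proof.
rewrite /section_density; case: ifP => // _; apply: fine_ge0.
exact/Radon_Nikodym_SigmaFinite.f_ge0/time_section_dominated.
Qed.

Lemma section_densityE s w : s < T%:num ->
  (section_density s w)%:E = Radon_Nikodym_SigmaFinite.f (time_section delta s) P w.
Proof.
move=> sT; rewrite /section_density sT fineK //.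
exact/Radon_Nikodym_SigmaFinite.f_fin_num/time_section_dominated.
Qed.

Lemma measurable_section_density s : measurable_fun setT (section_density s).
Proof.
have [sT|Ts] := ltP s T%:num; last first.
  by rewrite (_ : section_density s = cst 1) //; apply/funext => w;
    rewrite /section_density ltNge Ts.
apply/measurable_EFinP; rewrite (_ : _ \o _ =
  Radon_Nikodym_SigmaFinite.f (time_section delta s) P).
  apply: measurable_int; apply: Radon_Nikodym_SigmaFinite.f_integrable.
  exact: time_section_dominated.
by apply/funext => w /=; exact: section_densityE.
Qed.

Lemma integral_section_density s A : measurable A ->
  (\int[P]_(w in A) (section_density s w)%:E = delta (A `*` upto T s))%E.
Proof.
move=> mA; have [sT|Ts] := ltP s T%:num; last first.
  rewrite upto_ge // marginal // -[RHS]mul1e -integral_cst //.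
  by apply: eq_integral => w _; rewrite /section_density ltNge Ts.
under eq_integral do rewrite section_densityE //.
rewrite -Radon_Nikodym_SigmaFinite.f_integral //.
exact: time_section_dominated.
Qed.

Lemma section_density_mono s t : s <= t ->
  {ae P, forall w, section_density s w <= section_density t w}.
Proof.
move=> st; apply: ae_le_of_integral_le.
- exact: section_density_ge0.
- exact: section_density_ge0.
- exact/measurable_completion_measurable/measurable_section_density.
- exact/measurable_completion_measurable/measurable_section_density.
- by move=> A mA; rewrite !integral_section_density //; exact: time_section_le.
Qed.

Lemma section_densityT s w : T%:num <= s -> section_density s w = 1.
Proof. by rewrite /section_density leNgt => /negbTE ->. Qed.

Lemma time_section_right_cvg (A : set Omega) (t : R) : measurable A ->
  delta (A `*` upto T (t + n.+1%:R^-1)) @[n --> \oo] --> delta (A `*` upto T t).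
Proof.
move=> mA.
have capE : \bigcap_n (A `*` upto T (t + n.+1%:R^-1)) = A `*` upto T t.
  apply/seteqP; split => -[w u].
    move=> H; split; first by have [] := H 0%N Logic.I.
    rewrite /upto /= leNgt; apply/negP => /ltr_add_invr[n].
    by rewrite ltNge; have [_ ->] := H n Logic.I.
  move=> [Aw ut] n _; split => //; apply: le_trans ut _.
  by rewrite lerDl.
rewrite -capE.
apply: (@nonincreasing_cvg_mu _ _ _ delta (fun n => A `*` upto T (t + n.+1%:R^-1))).
- by rewrite ltey_eq fin_num_measure //; exact: measurable_setX_upto.
- by move=> n; exact: measurable_setX_upto.
- by rewrite capE; exact: measurable_setX_upto.
- move=> m n mn; apply/subsetPset; apply: setSX => // u /= us.
  by apply: le_trans us _; rewrite lerD2l lef_pV2 ?posrE // ler_nat ltnS.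
Qed.

Definition right_envelope (t : R) (w : Omega) : R :=
  inf [set section_density (ratr q) w | q in [set q : rat | t < ratr q]].

Lemma envelope_set_neq0 (t : R) w :
  [set section_density (ratr q) w | q in [set q : rat | t < ratr q]] !=set0.
Proof.
have : t < t + 1 by rewrite ltrDl.
move=> /rat_in_itvoo[q]; rewrite in_itv /= => /andP[tq _].
by exists (section_density (ratr q) w), q.
Qed.

Lemma right_envelope_le (t : R) (q : rat) w :
  t < ratr q -> right_envelope t w <= section_density (ratr q) w.
Proof.
move=> tq; apply: ge_inf; last by exists q.
by exists 0 => _ [r _ <-]; exact: section_density_ge0.
Qed.

Lemma le_right_envelope (t : R) w (c : R) :
  (forall q : rat, t < ratr q -> c <= section_density (ratr q) w) ->
  c <= right_envelope t w.
Proof.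
by move=> cq; apply: lb_le_inf; [exact: envelope_set_neq0|move=> _ [q /cq ? <-]].
Qed.

Lemma right_envelope_lt (t : R) w (c : R) : right_envelope t w < c ->
  exists2 q : rat, t < ratr q & section_density (ratr q) w < c.
Proof.
move=> /(inf_lt (envelope_set_neq0 t w))[_ [q tq <-] qc].
by exists q.
Qed.

Lemma right_envelope_ge0 t w : 0 <= right_envelope t w.
Proof. by apply: le_right_envelope => q _; exact: section_density_ge0. Qed.

Lemma right_envelope_le1 t w : right_envelope t w <= 1.
Proof.
have : Num.max t T%:num < Num.max t T%:num + 1 by rewrite ltrDl.
move=> /rat_in_itvoo[q]; rewrite in_itv /= => /andP[+ _].
rewrite gt_max => /andP[tq Tq].
by rewrite -(section_densityT _ w (ltW Tq)); exact: right_envelope_le.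
Qed.

Lemma right_envelopeT w : right_envelope T%:num w = 1.
Proof.
apply/eqP; rewrite eq_le right_envelope_le1; apply: le_right_envelope => q Tq.
by rewrite section_densityT // ltW.
Qed.

Lemma right_envelope_mono w : {homo right_envelope^~ w : s t / s <= t}.
Proof.
move=> s t st; apply: le_right_envelope => q tq; apply: right_envelope_le.
exact: le_lt_trans tq.
Qed.

(** If a rational [q > t] nearly attains the infimum at [t], it also takes part
    in the infimum at every [s] between [t] and [q]. *)
Lemma right_envelope_right_continuous w t :
  right_envelope s w @[s --> t^'+] --> right_envelope t w.
Proof.
apply/cvgrPdist_lt => e e0.
have /right_envelope_lt[q tq qe] : right_envelope t w < right_envelope t w + e.
  by rewrite ltrDl.
near=> s.
have ts : right_envelope t w <= right_envelope s w by apply: right_envelope_mono.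
rewrite distrC ger0_norm ?subr_ge0 // ltrBlDl; apply: le_lt_trans qe.
by apply: right_envelope_le; near: s; exact: nbhs_right_lt.
Unshelve. all: by end_near. Qed.

Lemma measurable_right_envelope t : measurable_fun setT (right_envelope t).
Proof.
move=> mD; apply: (measurability _ (RGenInftyO.measurableE R)) => //.
move=> _ [_ [c ->] <-]; rewrite setTI.
rewrite (_ : _ @^-1` _ = \bigcup_(q in [set q : rat | t < ratr q])
    (setT `&` section_density (ratr q) @^-1` `]-oo, c[)); last first.
  apply/seteqP; split => w /=; rewrite in_itv /=.
    by move=> /right_envelope_lt[q tq qc]; exists q => //=; rewrite in_itv.
  move=> [q tq] [_] /=; rewrite in_itv; apply: le_lt_trans.
  exact: right_envelope_le.
rewrite bigcup_mkcond; apply: bigcupT_measurable_rat => q; case: ifP => // _.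
by apply: measurable_section_density => //; exact: measurable_itv.
Qed.

(** The lower bound is pointwise, from the almost sure monotonicity of the
    densities along the rationals. The upper bound is obtained from integrals,
    by continuity of [delta] along the decreasing sets [A `*` [0, t + 1/(n+1)]]. *)
Lemma right_envelope_ae t : {ae P, forall w, right_envelope t w = section_density t w}.
Proof.
have le : {ae P, forall w, section_density t w <= right_envelope t w}.
  have : {ae P, forall w, forall q : rat, t < ratr q ->
      section_density t w <= section_density (ratr q) w}.
    apply: ae_forall_countable => q; have [tq|_] := ltP t (ratr q); last exact: aeW.
    by apply: filterS (section_density_mono _ _ (ltW tq)) => w.
  by apply: filterS => w; exact: le_right_envelope.
have ge : {ae P, forall w, right_envelope t w <= section_density t w}.
  apply: ae_le_of_integral_le.
  - exact: right_envelope_ge0.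
  - exact: section_density_ge0.
  - exact/measurable_completion_measurable/measurable_right_envelope.
  - exact/measurable_completion_measurable/measurable_section_density.
  move=> A mA; rewrite integral_section_density //.
  have cvgA := time_section_right_cvg A t mA.
  rewrite -(cvg_lim _ cvgA) //; apply: lime_ge.
    by apply/cvg_ex; eexists; exact: cvgA.
  apply: nearW => n.
  have : t < t + n.+1%:R^-1 by rewrite ltrDl.
  move=> /rat_in_itvoo[q]; rewrite in_itv /= => /andP[tq qn].
  apply: (@le_trans _ _ (delta (A `*` upto T (ratr q)))).
    rewrite -integral_section_density //.
    apply: ge0_le_integral_nonmeasurable => w _; rewrite lee_fin.
      exact: right_envelope_ge0.
    exact: right_envelope_le.
  by apply: time_section_le => //; exact: ltW.
by apply: filterS2 le ge => w le ge; apply/eqP; rewrite eq_le le ge.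
Qed.

Lemma integral_right_envelope t A : measurable A ->
  (\int[P]_(w in A) (right_envelope t w)%:E = delta (A `*` upto T t))%E.
Proof.
move=> mA; rewrite -integral_section_density //.
apply: ge0_ae_eq_integral => //.
- by apply/measurable_EFinP; apply: measurable_funTS; exact: measurable_right_envelope.
- by apply/measurable_EFinP; apply: measurable_funTS; exact: measurable_section_density.
- by move=> w _; rewrite lee_fin right_envelope_ge0.
- by move=> w _; rewrite lee_fin section_density_ge0.
- by apply: filterS (right_envelope_ae t) => w /= -> _.
Qed.

End section_density.

(** * Randomized stopping times *)

Section stopping_times.
Context {d} {Omega : measurableType d} {R : realType} {P : probability Omega R}.
Context {T : {posnum R}} {F : R -> set (set Omega)}.
Hypothesis hF : usual_filtration P T F.

Lemma filtration_measurable t : 0 <= t <= T%:num -> F t `<=` measurable.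
Proof.
move=> t0T A FA; rewrite (filtration_generates hF).
by apply: sub_sigma_algebra; exists t => //=; rewrite in_itv.
Qed.

Lemma filtration_null_at t N : 0 <= t <= T%:num ->
  measurable N -> P N = 0%E -> F t N.
Proof.
move=> /andP[t0 tT] mN PN.
by apply: (filtration_mono hF (lexx 0) t0 tT); exact: (filtration_null hF).
Qed.

(** Before [T] the process is almost everywhere equal to the Radon-Nikodym
    derivative, which is adapted by hypothesis; at [T] it is constant. *)
Lemma right_envelope_adapted (delta : probability (Omega * time T)%type R) t :
  distribution_stopping_time P F delta -> 0 <= t <= T%:num ->
  completion_measurable P (F t) (right_envelope P delta t).
Proof.
move=> hdelta t0T B mB; have marginal := dst_marginal hdelta.
have sF := filtration_sigma_algebra hF t0T.
have Fm := filtration_measurable _ t0T.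
have Fnull N := filtration_null_at t N t0T.
have [tT|Tt] := ltP t T%:num; last first.
  have tE : t = T%:num by apply: le_anti; rewrite Tt andbT; case/andP: t0T.
  have -> : right_envelope P delta t = cst 1.
    by apply/funext => w; rewrite tE right_envelopeT.
  have [F0 FD _] := sF; have FT : F t setT by rewrite -(setD0 setT); exact: FD.
  have [B1|nB1] := pselect (B 1).
    rewrite (_ : _ @^-1` _ = setT); last by apply/seteqP; split.
    by exists setT, setT; rewrite setDv measure0; split.
  rewrite (_ : _ @^-1` _ = set0); last by apply/seteqP; split.
  by exists set0, set0; rewrite setDv measure0; split.
(* The derivative takes extended real values: its preimage of the copy of B
   in the extended reals is compared with the preimage of B. *)
have mEB : measurable (EFin @` B : set (\bar R)) by exact: measurable_image_EFin.
apply: completion_ae_eq (dst_adapted hdelta t0T mEB) => //.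
have dom := time_section_dominated P delta marginal t.
have := ae_eq_Radon_Nikodym_SigmaFinite dom measurableT.
apply: filterS2 (right_envelope_ae P delta marginal t) => w E1 /(_ Logic.I) E2.
rewrite /preimage /= E1 -E2 -section_densityE //; split.
  by move=> [x Bx [<-]].
by move=> Bw; exists (section_density P delta t w).
Qed.

Lemma right_envelope_randomized_stopping_time
    (delta : probability (Omega * time T)%type R) :
  distribution_stopping_time P F delta ->
  randomized_stopping_time P T F (right_envelope P delta).
Proof.
move=> hdelta; have marginal := dst_marginal hdelta; split.
- by move=> t; exact: right_envelope_adapted.
- by move=> t w _; rewrite right_envelope_ge0 // right_envelope_le1.
- by move=> w s t _ st _; exact: right_envelope_mono.
- by move=> w t _; exact: right_envelope_right_continuous.
- by move=> w; exact: right_envelopeT.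
Qed.

(** Countably many times contribute countably many null sets; outside of them,
    right continuity propagates the equality from the rational times to all
    times before [T], and both processes equal [1] at [T]. *)
Lemma randomized_stopping_time_unique (rho rho' : R -> Omega -> R) :
  randomized_stopping_time P T F rho -> randomized_stopping_time P T F rho' ->
  (forall (t : R) A, 0 <= t <= T%:num -> measurable A ->
    (\int[P]_(w in A) (rho t w)%:E = \int[P]_(w in A) (rho' t w)%:E)%E) ->
  {ae P, forall w, forall t : R, 0 <= t <= T%:num -> rho t w = rho' t w}.
Proof.
move=> hrho hrho' Eint.
have cm (r : R -> Omega -> R) (t : R) : randomized_stopping_time P T F r ->
    0 <= t <= T%:num -> completion_measurable P measurable (r t).
  move=> hr t0T B mB; apply: completionS (filtration_measurable _ t0T) _ _.
  exact: rst_adapted hr _ t0T _ mB.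
have ge0 (r : R -> Omega -> R) (t : R) w : randomized_stopping_time P T F r ->
    0 <= t <= T%:num -> 0 <= r t w.
  by move=> hr t0T; have /andP[] := rst_itv hr w t0T.
have : {ae P, forall w, forall q : rat, 0 <= (ratr q : R) <= T%:num ->
    rho (ratr q) w = rho' (ratr q) w}.
  apply: ae_forall_countable => q.
  have [qT|_] := boolP (0 <= (ratr q : R) <= T%:num); last exact: aeW.
  have le1 : {ae P, forall w, rho (ratr q) w <= rho' (ratr q) w}.
    apply: ae_le_of_integral_le; [by move=> w; exact: ge0..|exact: cm|exact: cm|].
    by move=> A mA; rewrite Eint.
  have le2 : {ae P, forall w, rho' (ratr q) w <= rho (ratr q) w}.
    apply: ae_le_of_integral_le; [by move=> w; exact: ge0..|exact: cm|exact: cm|].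
    by move=> A mA; rewrite Eint.
  by apply: filterS2 le1 le2 => w l1 l2 _; apply/eqP; rewrite eq_le l1 l2.
apply: filterS => w Eq t /andP[t0 tT].
move: (tT); rewrite le_eqVlt => /predU1P[->|ltT].
  by rewrite (rst_final hrho) (rst_final hrho').
have t0T : 0 <= t < T%:num by rewrite t0.
apply: (@right_lim_eq_of_rat _ (rho^~ w) (rho'^~ w) t T%:num) => //.
- exact: rst_right_continuous hrho _ _ t0T.
- exact: rst_right_continuous hrho' _ _ t0T.
move=> q /andP[tq qT].
by apply: Eq; rewrite !ltW // (le_lt_trans t0).
Qed.

End stopping_times.

Theorem theorem2 (R : realType) (T : {posnum R})
    (d : measure_display) (Omega : measurableType d) (P : probability Omega R)
    (F : R -> set (set Omega)) (hF : usual_filtration P T F)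
    (delta : probability (Omega * time T)%type R)
    (hdelta : distribution_stopping_time P F delta) :
  exists rho : R -> Omega -> R,
    [/\ randomized_stopping_time P T F rho,
        equivalent_stopping_times P rho delta &
        forall rho' : R -> Omega -> R,
          randomized_stopping_time P T F rho' ->
          equivalent_stopping_times P rho' delta ->
          {ae P, forall w, forall t : R, 0 <= t <= T%:num -> rho t w = rho' t w}].
Proof.
have marginal := dst_marginal hdelta.
exists (right_envelope P delta); split.
- exact: right_envelope_randomized_stopping_time.
- by move=> t A _ mA; rewrite integral_right_envelope.
move=> rho' hrho' Erho'.
apply: (randomized_stopping_time_unique hF _ rho') => // [|t A t0T mA].
  exact: right_envelope_randomized_stopping_time.
by rewrite integral_right_envelope // Erho'.
Qed.
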